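(* Let $\mathcal{L}\subset\mathbb{R}^D$ be a lattice of minimum squared norm $m$, let $q>m$, and let $X\subset S^{D+k-1}\subset\mathbb{R}^D\oplus\mathbb{R}^k$ be a kissing configuration consisting of points $(u/\sqrt q,t)$ whose nonzero heads $u$ are minimal vectors of $\mathcal{L}$ (so $\|u\|^2=m$), together with pure-tail points $(0,p)$. For finitely many indices $i$, let $V_i\subset\mathcal{L}$ be a set of representatives of distinct antipodal lines, all of squared norm $b_i$, where $m<b_i\le q$. Adjoining to $X$ the points $(\pm v/\sqrt{b_i},0)$ for every $i$ and every $v\in V_i$ gives $|X|+2\sum_i|V_i|$ distinct points forming a kissing configuration if and only if $$|v\cdot w|\le\frac{\sqrt{b_ib_j}}2$$ for every two distinct labelled representatives $(v,i),(w,j)$ (with $v\in V_i$, $w\in V_j$). This condition on a pair is equivalent to $$\min\{\|v-w\|^2,\|v+w\|^2\}\ge b_i+b_j-\sqrt{b_ib_j}.$$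
   Context: A kissing configuration in $S^{n-1}\subset\mathbb{R}^n$ is a set of unit vectors whose distinct members have inner product at most $\tfrac12$. Representatives of distinct antipodal lines: $V_i$ contains at most one vector from each pair $\{v,-v\}$. Minimal vectors of a lattice are its nonzero vectors of least norm. *)

(* Defs.v *)
From HB Require Import structures.
From mathcomp Require Import all_boot all_order all_algebra.
From mathcomp Require Import finmap.
From mathcomp Require Import boolp classical_sets functions cardinality reals.

Set Implicit Arguments.
Unset Strict Implicit.
Unset Printing Implicit Defensive.
Import Order.TTheory GRing.Theory Num.Theory.
Local Open Scope classical_set_scope.
Local Open Scope ring_scope.

(* MathComp-Analysis' norm on 'rV[R]_n is the sup norm, hence these. *)
Definition dot (R : realType) (n : nat) (u v : 'rV[R]_n) : R :=
  \sum_(i < n) u 0 i * v 0 i.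

Definition sqnorm (R : realType) (n : nat) (u : 'rV[R]_n) : R := dot u u.

(* The integer span of linearly independent vectors, the rows of B; the rank r
   is allowed to be smaller than n. *)
Definition is_lattice (R : realType) (n : nat) (L : set 'rV[R]_n) : Prop :=
  exists (r : nat) (B : 'M[R]_(r, n)),
    row_free B /\
    L = [set u | exists c : 'rV[int]_r, u = map_mx (fun z : int => z%:~R) c *m B].

Definition minimal_vector (R : realType) (n : nat) (L : set 'rV[R]_n)
    (u : 'rV[R]_n) : Prop :=
  [/\ L u, u <> 0 & forall w, L w -> w <> 0 -> sqnorm u <= sqnorm w].

Definition min_sqnorm (R : realType) (n : nat) (L : set 'rV[R]_n) (m : R) :
    Prop :=
  exists2 u, minimal_vector L u & sqnorm u = m.

Definition kissing (R : realType) (n : nat) (X : set 'rV[R]_n) : Prop :=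
  (forall x, X x -> sqnorm x = 1) /\
  (forall x y, X x -> X y -> x <> y -> dot x y <= 2^-1).

Definition antipodal_representatives (R : realType) (n : nat)
    (V : set 'rV[R]_n) : Prop :=
  forall v : 'rV[R]_n, is_subset1 (V `&` [set v; - v]).

Definition adjoin (R : realType) (D k : nat) (I : finType)
    (X : set 'rV[R]_(D + k)) (b : I -> R) (V : I -> set 'rV[R]_D) :
    set 'rV[R]_(D + k) :=
  X `|` [set x | exists (i : I) (v : 'rV[R]_D), V i v /\
    (x = row_mx ((Num.sqrt (b i))^-1 *: v) 0 \/
     x = row_mx (- ((Num.sqrt (b i))^-1 *: v)) 0)].

(* fset_set sends infinite sets to fset0; below it is applied only to bounded
   sets with separated points, which are finite. *)
Definition fincard (T : choiceType) (A : set T) : nat := #|` fset_set A|%fset.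

(* Main.v *)
(* For a minimal vector u and v in L longer than u, minimality of |u| against
   u - v and u + v gives |u.v| <= |v|^2 / 2, so old and new points always have
   inner product at most sqrt (b_i / q) / 2 <= 1/2.  Hence only pairs of new
   points matter.  The two signs turn the inner product bound for a pair of
   labels into the absolute value bound; if two distinct labels give the same
   point then the count is too small, and the bound fails because the inner
   product is then 1. *)
Require Import Defs.
From HB Require Import structures.
From mathcomp Require Import all_boot all_order all_algebra.
From mathcomp Require Import finmap.
From mathcomp Require Import boolp classical_sets functions cardinality reals.
From mathcomp Require Import zify ring lra.

Set Implicit Arguments.
Unset Strict Implicit.
Unset Printing Implicit Defensive.
Import Order.TTheory GRing.Theory Num.Theory.
Local Open Scope classical_set_scope.
Local Open Scope card_scope.
Local Open Scope ring_scope.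

(** * Counting the image of a finite type *)

(** The image has as many elements as [undup (codom g)], and removing duplicates keeps the length
    [#|S|] only when there are none. This turns the counting claim into injectivity of an
    enumeration. *)
Lemma card_eq_range_inj (S : finType) (T : choiceType) (g : S -> T) :
  (range g #= `I_#|S|) <-> injective g.
Proof.
have [F FE cardF] : exists2 F : {fset T},
    F =i codom g & #|` F|%fset = size (undup (codom g)).
  by exists (seq_fset tt (codom g)); [exact: seq_fsetE|exact: size_seq_fset].
have -> : range g = [set` F].
  apply/seteqP; split=> x /=; rewrite FE.
    by move=> [s _ <-]; exact: codom_f.
  by move=> /codomP[s ->]; exists s.
split=> [/card_eq_fsetP|g_inj]; last first.
  apply/card_eq_fsetP; rewrite cardF undup_id ?size_codom//.
  exact/injectiveP.
rewrite cardF => size_eq; apply/injectiveP; rewrite /injectiveb /dinjectiveb.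
have := ltn_size_undup (codom g).
by rewrite size_eq size_codom ltnn => /esym/negbFE.
Qed.

(** * Inner products, and finiteness of kissing configurations *)

Section Dot.
Variables (R : realType) (n : nat).
Implicit Types x y z : 'rV[R]_n.

Lemma dotC x y : dot x y = dot y x.
Proof. by apply: eq_bigr => i _; rewrite mulrC. Qed.

Lemma dotDl x y z : dot (x + y) z = dot x z + dot y z.
Proof. by rewrite -big_split; apply: eq_bigr => i _; rewrite mxE mulrDl. Qed.

Lemma dotZl (a : R) x y : dot (a *: x) y = a * dot x y.
Proof. by rewrite mulr_sumr; apply: eq_bigr => i _; rewrite mxE mulrA. Qed.

Lemma dotZr (a : R) x y : dot x (a *: y) = a * dot x y.
Proof. by rewrite dotC dotZl dotC. Qed.

Lemma dotNr x y : dot x (- y) = - dot x y.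
Proof. by rewrite -scaleN1r dotZr mulN1r. Qed.

Lemma dot0l x : dot 0 x = 0.
Proof. by rewrite -(scale0r x) dotZl mul0r. Qed.

Lemma dot0r x : dot x 0 = 0.
Proof. by rewrite dotC dot0l. Qed.

Lemma sqnormD x y : sqnorm (x + y) = sqnorm x + sqnorm y + 2 * dot x y.
Proof.
rewrite /sqnorm dotDl !(dotC _ (x + y)) !dotDl (dotC y x).
by ring.
Qed.

Lemma sqnormN x : sqnorm (- x) = sqnorm x.
Proof. by rewrite /sqnorm dotNr dotC dotNr opprK. Qed.

Lemma sqnormB x y : sqnorm (x - y) = sqnorm x + sqnorm y - 2 * dot x y.
Proof. by rewrite sqnormD sqnormN dotNr mulrN. Qed.

Lemma sqnorm_gt0 x : x <> 0 -> 0 < sqnorm x.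
Proof.
move=> /eqP x0; rewrite lt_def sumr_ge0 => [|i _]; last first.
  by rewrite -expr2 sqr_ge0.
rewrite andbT psumr_eq0 => [|i _]; last by rewrite -expr2 sqr_ge0.
apply: contra x0 => /allP x0; apply/eqP/rowP => i; rewrite mxE.
by have := x0 i (mem_index_enum i); rewrite /= mulf_eq0 orbb => /eqP.
Qed.

Lemma normr_entry_le1 x (i : 'I_n) : sqnorm x = 1 -> `|x 0 i| <= 1.
Proof.
move=> x1; rewrite -[leRHS](sqrtr1 R) -sqrtr_sqr ler_wsqrtr// -x1 /sqnorm /dot.
rewrite (bigD1 i)//= expr2 lerDl sumr_ge0// => j _.
by rewrite -expr2 sqr_ge0.
Qed.

(* Distinct points of a kissing configuration are at distance at least 1, so a
   grid of mesh 1/(n+1) has at most one of them in each cell. *)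
Lemma kissing_finite (X : set 'rV[R]_n) : kissing X -> finite_set X.
Proof.
move=> [X1 XX].
pose N : R := n.+1%:R.
(* Entries of a unit vector lie in [-1, 1]. The shift by 1 makes truncation a floor, with values
   from 0 to 2(n+1), the last one reached at entry 1; hence 2(n+1)+1 cells per axis, and [inord] is
   faithful on [X]. *)
pose t (x : 'rV[R]_n) i := Num.truncn ((x 0 i + 1) * N).
pose cell x := [ffun i => inord (t x i) : 'I_(2 * n.+1).+1].
have N0 : 0 < N by rewrite ltr0n.
have tP x i : X x -> (t x i)%:R <= (x 0 i + 1) * N < (t x i).+1%:R.
  move=> /X1 /(@normr_entry_le1 _ i); rewrite ler_norml => /andP[x1 _].
  by apply: truncn_itv; apply: mulr_ge0; [lra|exact: ltW].
have t_lt x i : X x -> (t x i < (2 * n.+1).+1)%N.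
  move=> Xx; have /andP[le_t _] := tP x i Xx.
  rewrite ltnS -(ler_nat R) (le_trans le_t)// natrM ler_wpM2r ?(ltW N0)//.
  have := @normr_entry_le1 _ i (X1 _ Xx); rewrite ler_norml => /andP[_].
  by lra.
have cell_inj : {in X &, injective cell}.
  move=> x y; rewrite !inE => Xx Xy cxy; apply: contrapT => neq_xy.
  have close i : (x - y) 0 i * (x - y) 0 i <= N ^- 2.
    have txy : t x i = t y i.
      have := congr1
        (fun f : {ffun 'I_n -> 'I_(2 * n.+1).+1} => nat_of_ord (f i)) cxy.
      by rewrite !ffunE !inordK ?t_lt.
    have := tP x i Xx; have := tP y i Xy; rewrite txy -natr1.
    move=> /andP[y1 y2] /andP[x1 x2].
    rewrite !mxE -expr2 -exprVn -ler_sqrt ?sqr_ge0//.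
    rewrite !sqrtr_sqr (@gtr0_norm _ N^-1) ?invr_gt0//.
    rewrite -[leRHS]mul1r ler_pdivlMr// -(gtr0_norm N0) -normrM mulrBl.
    by rewrite ler_norml; lra.
  have := XX _ _ Xx Xy neq_xy.
  (* Two points in one cell differ by at most 1/(n+1) in each of n entries, and n < (n+1)^2. The
     kissing bound gives squared distance at least 2 - 1 = 1 instead. *)
  have : sqnorm (x - y) < 1.
    apply: (@le_lt_trans _ _ (\sum_(i < n) N ^- 2)); first exact: ler_sum.
    rewrite sumr_const card_ord -mulr_natl ltr_pdivrMr ?exprn_gt0// mul1r.
    rewrite -natrX ltr_nat; nia.
  rewrite sqnormB (X1 _ Xx) (X1 _ Xy); lra.
by have /eq_finite_set <- := inj_card_eq cell_inj; exact: finite_finset.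
Qed.

End Dot.

Lemma dot_row_mx (R : realType) (n k : nat) (x y : 'rV[R]_n) (s t : 'rV[R]_k) :
  dot (row_mx x s) (row_mx y t) = dot x y + dot s t.
Proof.
rewrite /dot big_split_ord /=.
by congr (_ + _); apply: eq_bigr => i _; rewrite ?row_mxEl ?row_mxEr.
Qed.

(** * Lattice vectors against minimal vectors *)

Lemma lattice_subr (R : realType) (n : nat) (L : set 'rV[R]_n) u v :
  is_lattice L -> L u -> L v -> L (u - v).
Proof.
move=> [r [B [_ ->]]] [c ->] [d ->]; exists (c - d).
by rewrite map_mxB mulmxBl.
Qed.

Lemma minimal_vector_dot_le (R : realType) (n : nat) (L : set 'rV[R]_n) u v :
  is_lattice L -> minimal_vector L u -> L v -> sqnorm u < sqnorm v ->
  `|dot u v| <= sqnorm v / 2.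
Proof.
move=> latL [Lu u0 u_min] Lv ltuv.
have Lsub := lattice_subr latL.
have LNv : L (- v).
  by rewrite -sub0r -(subrr v); apply: (Lsub _ _ _ Lv); exact: Lsub.
have le_sub w : L w -> sqnorm w = sqnorm v -> sqnorm u <= sqnorm (u - w).
  move=> Lw wv; apply: u_min; first exact: Lsub.
  (* Strictness of [ltuv] keeps the difference nonzero, as minimality requires. *)
  by move=> /eqP; rewrite subr_eq0 => /eqP uw; move: ltuv; rewrite -wv uw ltxx.
have := le_sub _ Lv erefl; have := le_sub _ LNv (sqnormN v).
by rewrite opprK sqnormB sqnormD ler_norml; lra.
Qed.

(** * The adjoined points and their number *)

Section SignedPoint.
Variables (R : realType) (D k : nat).
Implicit Types (a b : R) (v w : 'rV[R]_D).

(** A boolean sign makes the two points of a label a finite family of size 2, which supplies the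
    factor 2 in the count. *)
Definition signed_point b (e : bool) v : 'rV[R]_(D + k) :=
  row_mx ((-1) ^+ e *: ((Num.sqrt b)^-1 *: v)) 0.

Lemma dot_signed_point a b (e f : bool) v w : 0 <= a ->
  dot (signed_point a e v) (signed_point b f w) =
  (-1) ^+ e * (-1) ^+ f * (dot v w / Num.sqrt (a * b)).
Proof.
move=> a0; rewrite dot_row_mx dot0l addr0 !dotZl !dotZr sqrtrM// invfM.
by ring.
Qed.

Lemma sqnorm_signed_point (e : bool) v :
  0 < sqnorm v -> sqnorm (signed_point (sqnorm v) e v) = 1.
Proof.
move=> v0; rewrite {1}/sqnorm dot_signed_point ?ltW// -signr_addb addbb mul1r.
by rewrite -expr2 sqrtr_sqr gtr0_norm// divff// gt_eqF.
Qed.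

Lemma signed_point_inj b (e : bool) : 0 < b -> injective (signed_point b e).
Proof.
move=> b0 v w /eq_row_mx[eq_vw _].
apply: (@scalerI _ _ (Num.sqrt b)^-1).
  by rewrite invr_eq0 gt_eqF// sqrtr_gt0.
by apply: scalerI eq_vw; rewrite signr_eq0.
Qed.

Lemma dot_signed_point_le a b v w : 0 < a -> 0 < b ->
  (forall e f, dot (signed_point a e v) (signed_point b f w) <= 2^-1) <->
  `|dot v w| <= Num.sqrt (a * b) / 2.
Proof.
move=> a0 b0; have ab0 : 0 < Num.sqrt (a * b) by rewrite sqrtr_gt0 mulr_gt0.
have -> : (`|dot v w| <= Num.sqrt (a * b) / 2) =
          (`|dot v w / Num.sqrt (a * b)| <= 2^-1).
  by rewrite normrM normfV (gtr0_norm ab0) ler_pdivrMr// mulrC.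
rewrite ler_norml; split=> [le_dot|/andP[le1 le2] e f].
  (* Only the product of the signs matters, so one equal and one opposite pair give both sides of
     the absolute value. *)
  have := le_dot false false; have := le_dot true false.
  by rewrite !dot_signed_point ?(ltW a0)//= expr0 expr1; lra.
rewrite dot_signed_point ?(ltW a0)//.
by case: e f => [] [] /=; rewrite ?expr0 ?expr1; lra.
Qed.

(** Opposite signs give antipodal points. This covers distinct new points with the same label, a
    case that the bound on distinct labels does not reach. *)
Lemma dot_signed_point_neq (e f : bool) b v : 0 <= b -> e != f ->
  dot (signed_point b e v) (signed_point b f v) = - sqnorm (signed_point b e v).
Proof.
move=> b0; rewrite /sqnorm !dot_signed_point// => neq.
by case: e f neq => [] [] //= _; ring.
Qed.

Lemma adjoin_signed_pointE (I : finType) (X : set 'rV[R]_(D + k)) (b : I -> R)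
    (V : I -> set 'rV[R]_D) x :
  adjoin X b V x <->
  X x \/ exists i e v, V i v /\ x = signed_point (b i) e v.
Proof.
split=> -[Xx|H]; [by left| |by left|]; right.
  move: H => [i [v [Vv [->|->]]]]; [exists i, false, v|exists i, true, v].
    by rewrite /signed_point scale1r.
  by rewrite /signed_point scaleN1r.
move: H => [i [[] [v [Vv ->]]]]; exists i, v; split => //; [right|left].
  by rewrite /signed_point scaleN1r.
by rewrite /signed_point scale1r.
Qed.

(** The number is the size of the disjoint union of [X] and the signed labels. This union maps onto
    [adjoin X b V], so the count is exact precisely when the map is injective, which the two clauses
    spell out. *)
Lemma card_adjoin (I : finType) (X : set 'rV[R]_(D + k)) (b : I -> R)
    (V : I -> set 'rV[R]_D) :
  finite_set X -> (forall i, finite_set (V i)) ->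
  (adjoin X b V #= `I_(fincard X + 2 * \sum_(i : I) fincard (V i))%N) <->
  (forall x i e v, X x -> V i v -> x <> signed_point (b i) e v) /\
  (forall i j e f v w, V i v -> V j w ->
     signed_point (b i) e v = signed_point (b j) f w ->
     [/\ i = j, e = f & v = w]).
Proof.
move=> finX finV.
pose S : finType := (fset_set X + {i : I & (fset_set (V i) * bool)%type})%type.
pose g (s : S) : 'rV[R]_(D + k) := match s with
  | inl x => val x
  | inr (existT i ve) => signed_point (b i) ve.2 (val ve.1)
  end.
have cardS : #|{: S}| = (fincard X + 2 * \sum_(i : I) fincard (V i))%N.
  rewrite card_sum card_tagged sumnE big_map big_enum/= /fincard cardfE.
  rewrite big_distrr/=; congr (_ + _)%N; apply: eq_bigr => i _.
  by rewrite card_prod card_bool mulnC cardfE.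
have memX x : (x \in fset_set X) <-> X x by rewrite in_fset_set// inE.
have memV i v : (v \in fset_set (V i)) <-> V i v by rewrite in_fset_set// inE.
have -> : adjoin X b V = range g.
  apply/seteqP; split=> x.
    move=> /adjoin_signed_pointE[/memX Xx|[i [e [v [/memV Vv ->]]]]].
      by exists (inl [` Xx]%fset).
    by exists (inr (existT _ i ([` Vv]%fset, e))).
  move=> [[y|[i [v e]]] _ <-]; apply/adjoin_signed_pointE.
    by left; apply/memX; exact: valP.
  by right; exists i, e, (val v); split=> //; apply/memV; exact: valP.
rewrite -cardS; apply: (iff_trans (card_eq_range_inj g)).
split=> [g_inj|[neqX injV] s t].
  split=> [x i e v /memX Xx /memV Vv|i j e f v w /memV Vv /memV Vw] eq_pt.
    by have := g_inj (inl [` Xx]%fset) (inr (existT _ i ([` Vv]%fset, e))) eq_pt.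
  have := g_inj (inr (existT _ i ([` Vv]%fset, e)))
                (inr (existT _ j ([` Vw]%fset, f))) eq_pt.
  (* [h] reads off the label in a non-dependent type, which avoids an equality between dependent
     pairs. *)
  pose h (s : S) := if s is inr (existT i ve) then Some (i, ve.2, val ve.1)
                    else None.
  by move=> /(congr1 h)[-> -> ->].
have XP (y : fset_set X) : X (val y) by apply/memX; exact: valP.
have VP i (v : fset_set (V i)) : V i (val v) by apply/memV; exact: valP.
case: s t => [x|[i [v e]]] [y|[j [w f]]] /=.
- by move=> /val_inj ->.
- by move=> /neqX-/(_ (XP _) (VP _ _)).
- by move=> /esym/neqX-/(_ (XP _) (VP _ _)).
- move=> /injV-/(_ (VP _ _) (VP _ _))[eq_ij -> eq_vw].
  by move: eq_ij w eq_vw => <- w /val_inj ->.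
Qed.

End SignedPoint.

Theorem proposition7p6 (R : realType) (D k : nat) (L : set 'rV[R]_D) (m q : R)
    (X : set 'rV[R]_(D + k)) (I : finType) (b : I -> R)
    (V : I -> set 'rV[R]_D)
    (L_lattice : is_lattice L)
    (L_min : min_sqnorm L m)
    (m_lt_q : m < q)
    (X_kissing : kissing X)
    (X_points : forall x, X x ->
      (exists (u : 'rV[R]_D) (t : 'rV[R]_k),
         minimal_vector L u /\ x = row_mx ((Num.sqrt q)^-1 *: u) t) \/
      (exists p : 'rV[R]_k, x = row_mx 0 p))
    (V_sub : forall i, V i `<=` L)
    (V_reps : forall i, antipodal_representatives (V i))
    (V_sqnorm : forall i v, V i v -> sqnorm v = b i)
    (b_bounds : forall i, m < b i <= q) :
  ((adjoin X b V #= `I_(fincard X + 2 * \sum_(i : I) fincard (V i))%N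
    /\ kissing (adjoin X b V))
   <->
   (forall (i j : I) (v w : 'rV[R]_D), V i v -> V j w -> (v, i) <> (w, j) ->
      `|dot v w| <= Num.sqrt (b i * b j) / 2))
  /\
  (forall (i j : I) (v w : 'rV[R]_D), V i v -> V j w -> (v, i) <> (w, j) ->
     (`|dot v w| <= Num.sqrt (b i * b j) / 2
      <->
      b i + b j - Num.sqrt (b i * b j)
        <= Num.min (sqnorm (v - w)) (sqnorm (v + w)))).
Proof.
have m_gt0 : 0 < m by have [u [_ u0 _] <-] := L_min; exact: sqnorm_gt0.
have b_gt0 i : 0 < b i by have /andP[/(lt_trans m_gt0)] := b_bounds i.
pose pt i := @signed_point R D k (b i).
have pt1 i e v : V i v -> sqnorm (pt i e v) = 1.
  move=> Vv; have := b_gt0 i; rewrite /pt -(V_sqnorm _ _ Vv).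
  exact: sqnorm_signed_point.
have dotX x i e v : X x -> V i v -> dot x (pt i e v) <= 2^-1.
  move=> Xx Vv; have /andP[mb bq] := b_bounds i.
  have [[u [t [u_min ->]]]|[p ->]] := X_points _ Xx; last first.
    by rewrite dot_row_mx dot0l dot0r addr0 invr_ge0.
  (* Two minimal vectors bound each other's norm. *)
  have um : sqnorm u = m.
    have [w [Lw w0 w_min] <-] := L_min; have [Lu u0 u_le] := u_min.
    by apply/eqP; rewrite eq_le u_le// w_min.
  have uv := minimal_vector_dot_le L_lattice u_min (V_sub _ _ Vv).
  rewrite um (V_sqnorm _ _ Vv) in uv; have {uv} := uv mb.
  have sqb : 0 < Num.sqrt (b i) by rewrite sqrtr_gt0.
  have sqq : Num.sqrt (b i) <= Num.sqrt q by rewrite ler_wsqrtr.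
  have sqq0 := lt_le_trans sqb sqq.
  rewrite -{1}(sqr_sqrtr (ltW (b_gt0 i))) ler_norml => /andP[uv1 uv2].
  have -> : dot (row_mx ((Num.sqrt q)^-1 *: u) t) (pt i e v) =
            (Num.sqrt q * Num.sqrt (b i))^-1 * ((-1) ^+ e * dot u v).
    by rewrite dot_row_mx dot0r addr0 !dotZl !dotZr invfM; ring.
  rewrite ler_pdivrMl ?mulr_gt0//.
  (* Since b_i <= q, the bound b_i / 2 on |u.v| is at most sqrt q * sqrt b_i / 2, the cleared form
     of 1/2. *)
  have : Num.sqrt (b i) ^+ 2 <= Num.sqrt q * Num.sqrt (b i).
    by rewrite expr2 ler_wpM2r ?(ltW sqb).
  by case: e => /=; rewrite ?expr0 ?expr1; lra.
have neqX x i e v : X x -> V i v -> x <> pt i e v.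
  move=> Xx Vv x_pt; have := dotX x i e v Xx Vv.
  (* A common point would have inner product 1 with itself. *)
  by rewrite x_pt -/(sqnorm _) pt1//; lra.
have finX : finite_set X by exact: kissing_finite X_kissing.
(* [V i] embeds into the adjoined configuration, which is finite once it is kissing; so [fincard]
   does count [V i]. *)
have finV : kissing (adjoin X b V) -> forall i, finite_set (V i).
  move=> /kissing_finite finA i.
  have /eq_finite_set <- : [set pt i false v | v in V i] #= V i.
    by apply: inj_card_eq => v w _ _; exact: signed_point_inj.
  apply: sub_finite_set finA => _ [v Vv <-]; apply/adjoin_signed_pointE.
  by right; exists i, false, v.
split; last first.
  move=> i j v w Vv Vw _; rewrite sqnormB sqnormD.
  rewrite !(V_sqnorm _ _ Vv) !(V_sqnorm _ _ Vw).
  (* |v - w|^2 and |v + w|^2 are b_i + b_j minus and plus 2 v.w, so each term of the minimum matches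
     one side of the absolute value bound. *)
  rewrite ler_norml le_min; split=> /andP[le1 le2]; apply/andP; split; lra.
split=> [[cardA kissA] i j v w Vv Vw neq_vw|le_dot].
  have [_ pt_inj] := (card_adjoin b finX (finV kissA)).1 cardA.
  apply/(@dot_signed_point_le _ D k) => // e f; apply: kissA.2.
  - by apply/adjoin_signed_pointE; right; exists i, e, v.
  - by apply/adjoin_signed_pointE; right; exists j, f, w.
  (* The exact count separates the points of distinct labels, so the kissing bound applies to every
     choice of signs. *)
  - by move=> /pt_inj-/(_ Vv Vw)[ij _ vw]; apply: neq_vw; rewrite ij vw.
have dot_pt i j e f v w : V i v -> V j w -> (v, i) <> (w, j) ->
    dot (pt i e v) (pt j f w) <= 2^-1.
  move=> Vv Vw neq_vw; have := le_dot _ _ _ _ Vv Vw neq_vw.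
  by move=> /(dot_signed_point_le k _ _ (b_gt0 i) (b_gt0 j))/(_ e f).
(* Kissing comes before the count, since the finiteness of each [V i] is drawn from it. *)
have kissA : kissing (adjoin X b V).
  split=> [x|x y] /adjoin_signed_pointE Ax.
    by case: Ax => [/X_kissing.1//|[i [e [v [Vv ->]]]]]; exact: pt1.
  move=> /adjoin_signed_pointE Ay.
  case: Ax Ay => [Xx|[i [e [v [Vv ->]]]]] [Xy|[j [f [w [Vw ->]]]]] neq_xy.
  - exact: X_kissing.2.
  - exact: dotX.
  - by rewrite dotC; exact: dotX.
  - have [[vw ij]|neq_vw] := pselect ((v, i) = (w, j)); last exact: dot_pt.
    have neq_ef : e != f by apply: contra_notN neq_xy => /eqP ->; rewrite vw ij.
    rewrite -vw -ij (dot_signed_point_neq k v (ltW (b_gt0 i)) neq_ef).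
    by have := pt1 i e v Vv; rewrite /pt => ->; lra.
split=> //; apply/(card_adjoin b finX (finV kissA)); split=> //.
move=> i j e f v w Vv Vw eq_pt.
(* Equal points have inner product 1, which the bound forbids for distinct labels; for one label
   with opposite signs it would also be -1. *)
have [[vw ij]|/dot_pt-/(_ e f Vv Vw)] := pselect ((v, i) = (w, j)); last first.
  by rewrite /pt eq_pt -/(sqnorm _) -/(pt _) pt1//; lra.
split=> //; apply/eqP; apply: contra_eqT eq_pt => neq_ef.
apply/eqP => eq_pt; rewrite -vw -ij in eq_pt.
have := dot_signed_point_neq k v (ltW (b_gt0 i)) neq_ef.
by rewrite -eq_pt -/(sqnorm _) (pt1 i e v Vv); lra.
Qed.
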